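(* Let $M$ be a locally Gaussian monoid, $\mathcal X$ a generating subset of $M$ with $1\notin\mathcal X$ that is closed under right lcm and under left and right complement, and $<$ a linear ordering on $\mathcal X$. Then the sequence $(C_*,\partial_* )$ defined in the context is a resolution of the trivial $\mathbb{Z}M$-module $\mathbb{Z}$ (by free $\mathbb{Z}M$-modules), i.e. the sequence $\cdots\to C_2\xrightarrow{\partial_2}C_1\xrightarrow{\partial_1}C_0\xrightarrow{\partial_0}\mathbb{Z}\to 0$ is exact.
   Context: For $x,y$ in a monoid $M$: $x$ is a left divisor of $y$, and $y$ a right multiple of $x$, if $y=xz$ for some $z$; proper if one can take $z\neq1$. Right divisors and left multiples are symmetric ($y=zx$). $M$ is locally Gaussian if it is (left and right) cancellative, neither proper left divisibility nor proper right divisibility admits an infinite descending sequence, any two elements with a common left multiple have a left lcm (a common left multiple of which every common left multiple is a left multiple), and any two elements with a common right multiple have a right lcm. When it exists, $x\vee y$ is the left lcm, and the left complement $x_{/y}$ is the unique element with $x_{/y}\,y=x\vee y$; the right complement ${}_{x\backslash}y$ is the unique element such that $x\cdot{}_{x\backslash}y$ is the right lcm of $x,y$. ''Closed under right lcm'' means that the right lcm of $x,y\in\mathcal X$ lies in $\mathcal X$ whenever $x,y$ have a common right multiple; ''closed under left (right) complement'' means that $x_{/y}$ (resp. ${}_{x\backslash}y$), for $x,y\in\mathcal X$, lies in $\mathcal X\cup\{1\}$ whenever defined. For $n\ge0$, $\mathcal X^{[n]}$ is the set of all strictly $<$-increasing $n$-tuples $(\alpha_1,\dots,\alpha_n)$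 of elements of $\mathcal X$ that admit a left lcm; $C_n$ is the free left $\mathbb{Z}M$-module on symbols $[A]$, $A\in\mathcal X^{[n]}$ ($n$-cells); $[\emptyset]$ is the unique $0$-cell. For arbitrary $\alpha_1,\dots,\alpha_n\in\mathcal X\cup\{1\}$ with a common left multiple, $[\alpha_1,\dots,\alpha_n]$ denotes $\operatorname{sgn}(f)[\alpha_{f(1)},\dots,\alpha_{f(n)}]$ if the $\alpha_i$ are pairwise distinct elements of $\mathcal X$ and $f$ is the permutation putting them in increasing order, and $0$ otherwise (a repetition, or some $\alpha_i=1$). For $A=(\alpha_1,\dots,\alpha_n)$, $A^i$ is $A$ with its $i$-th term removed; $A^i_{/\alpha_i}$ is the sequence obtained by replacing each term $\alpha_j$ ($j\ne i$) of $A^i$ by $(\alpha_j)_{/\alpha_i}$; and $(\alpha_i)_{/A^i}$ is the left complement of $\alpha_i$ in the left lcm of $A^i$ (equal to $\alpha_i$ if $A^i$ is empty). The $\mathbb{Z}M$-linear map $\partial_n:C_n\to C_{n-1}$ ($n\ge1$) is $$\partial_n[A]=\sum_{i=1}^n(-1)^i[A^i_{/\alpha_i}]-\sum_{i=1}^n(-1)^i(\alpha_i)_{/A^i}\,[A^i],$$ and $\partial_0:C_0\to\mathbb{Z}$ is the $\mathbb{Z}M$-linear map with $\partial_0[\emptyset]=1$, where $\mathbb{Z}$ has trivial $M$-action. *)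

(* Defs.v *)
From HB Require Import structures.
From mathcomp Require Import all_boot all_order all_fingroup all_algebra.
From mathcomp Require Import finmap.
From mathcomp Require Import boolp classical_sets.
From mathcomp.multinomials Require Import monalg.

Set Implicit Arguments.
Unset Strict Implicit.
Unset Printing Implicit Defensive.

Import GRing.Theory.

Section Divisibility.
Local Open Scope group_scope.
Variable M : monoidType.
Implicit Types (x y z m : M) (s : seq M).

Definition left_multiple m x : Prop := exists z, m = z * x.
Definition right_multiple m x : Prop := exists z, m = x * z.

Definition proper_left_divisor x y : Prop := exists2 z, z != 1 & y = x * z.
Definition proper_right_divisor x y : Prop := exists2 z, z != 1 & y = z * x.

Definition common_left_multiple s m : Prop := {in s, forall x, left_multiple m x}.
Definition common_right_multiple s m : Prop := {in s, forall x, right_multiple m x}.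

Definition is_left_lcm s m : Prop :=
  common_left_multiple s m /\
  forall m', common_left_multiple s m' -> left_multiple m' m.
Definition is_right_lcm s m : Prop :=
  common_right_multiple s m /\
  forall m', common_right_multiple s m' -> right_multiple m' m.

Definition has_left_lcm s : Prop := exists m, is_left_lcm s m.
Definition has_right_lcm s : Prop := exists m, is_right_lcm s m.

(* These are meaningful only when the lcm exists; otherwise the value is
   irrelevant. In a locally Gaussian monoid lcms and complements are unique. *)
Definition left_lcm s : M := xget 1 [set m | is_left_lcm s m]%classic.
Definition right_lcm s : M := xget 1 [set m | is_right_lcm s m]%classic.

(* x_{/y}: the element z such that z * y is the left lcm of x and y. *)
Definition left_complement x y : M :=
  xget 1 [set z | z * y = left_lcm [:: x; y]]%classic.
(* _{x\}y: the element z such that x * z is the right lcm of x and y. *)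
Definition right_complement x y : M :=
  xget 1 [set z | x * z = right_lcm [:: x; y]]%classic.

End Divisibility.

HB.mixin Record Monoid_isLocallyGaussian M of Monoid M := {
  lg_cancell : forall z x y : M, (z * x = z * y -> x = y)%g;
  lg_cancelr : forall z x y : M, (x * z = y * z -> x = y)%g;
  lg_left_noetherian :
    ~ exists u : nat -> M, forall n, proper_left_divisor (u n.+1) (u n);
  lg_right_noetherian :
    ~ exists u : nat -> M, forall n, proper_right_divisor (u n.+1) (u n);
  lg_left_lcm : forall x y : M,
    (exists m, common_left_multiple [:: x; y] m) -> has_left_lcm [:: x; y];
  lg_right_lcm : forall x y : M,
    (exists m, common_right_multiple [:: x; y] m) -> has_right_lcm [:: x; y]
}.

#[short(type="locallyGaussianType")]
HB.structure Definition LocallyGaussian :=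
  { M of Monoid M & Monoid_isLocallyGaussian M }.

(* The monoid ring {malg int[M]} needs M to have no invertible element other
   than 1; this follows from the absence of infinite descending sequences. *)
Lemma lg_conical (M : locallyGaussianType) (x y : M) :
  (x * y = 1 -> x = 1 /\ y = 1)%g.
Proof.
move=> xy1; case: (eqVneq x 1%g) => [x1|x_neq1].
  by split=> //; rewrite -xy1 x1 mul1g.
case: (@lg_left_noetherian M); exists (fun n => if odd n then x else 1%g) => n.
rewrite /=; case: (odd n) => /=; first by exists x; rewrite ?mul1g.
exists y => //; apply: contra_neq x_neq1 => y1.
by rewrite -xy1 y1 mulg1.
Qed.

#[non_forgetful_inheritance]
HB.instance Definition _ (M : locallyGaussianType) :=
  Choice_isMonomialDef.Build M
    (@mulgA M) (@mul1g M) (@mulg1 M) (@lg_conical M).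

Local Open Scope ring_scope.

Notation "''Z[' M ]" := ({malg int[M]}) (at level 8, format "''Z[' M ]").

Section TrivialModule.
Variable M : locallyGaussianType.

Definition cst1 (m : M) : int := 1.

Fact cst1_is_multiplicative : mmorphism cst1.
Proof. by split=> // x y; rewrite /cst1 mulr1. Qed.
HB.instance Definition _ :=
  isMultiplicative.Build M int cst1 cst1_is_multiplicative.

(* The ring morphism ZM -> Z sending every m in M to 1. *)
Definition augmentation : {rmorphism 'Z[M] -> int} := mmap idfun cst1.

Definition trivialZ of locallyGaussianType : Type := int.
HB.instance Definition _ := GRing.Zmodule.copy (trivialZ M) int.

Definition trivial_scale (a : 'Z[M]) (z : trivialZ M) : trivialZ M :=
  (augmentation a * z : int).

Fact trivial_scaleA a b z :
  trivial_scale a (trivial_scale b z) = trivial_scale (a * b) z.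
Proof. by rewrite /trivial_scale rmorphM mulrA. Qed.
Fact trivial_scale1 : left_id 1 trivial_scale.
Proof. by move=> z; rewrite /trivial_scale rmorph1 mul1r. Qed.
Fact trivial_scaleDr : right_distributive trivial_scale +%R.
Proof. by move=> a z1 z2; rewrite /trivial_scale mulrDr. Qed.
Fact trivial_scaleDl z : {morph trivial_scale^~ z : a b / a + b}.
Proof. by move=> a b; rewrite /trivial_scale rmorphD mulrDl. Qed.
HB.instance Definition _ := GRing.Zmodule_isLmodule.Build 'Z[M] (trivialZ M)
  trivial_scaleA trivial_scale1 trivial_scaleDr trivial_scaleDl.

End TrivialModule.

(* {malg R[K]} is the free left R-module with basis << k >>, k : K; this is the
   R-linear extension of a map defined on that basis. *)
Section LinearExtension.
Variables (R : nzRingType) (K : choiceType) (V : lmodType R) (f : K -> V).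

Definition linear_ext (x : {malg R[K]}) : V := \sum_(k <- msupp x) x@_k *: f k.

Lemma linear_extEw (D : {fset K}) (x : {malg R[K]}) :
  (msupp x `<=` D)%fset -> linear_ext x = \sum_(k <- D) x@_k *: f k.
Proof.
move=> sxD; rewrite /linear_ext (big_fset_incl _ sxD) // => k _ kx.
by rewrite mcoeff_outdom // scale0r.
Qed.

Fact linear_ext_is_linear : linear linear_ext.
Proof.
move=> a x y; pose D := (msupp x `|` msupp y `|` msupp (a *: x + y))%fset.
rewrite !(@linear_extEw D) /D ?fsubsetUr //; first last.
- by rewrite -fsetUA fsubsetUl.
- by rewrite fsubsetU // fsubsetUr.
rewrite scaler_sumr -big_split /=; apply: eq_bigr => k _.
by rewrite mcoeffD mcoeffZ scalerDl scalerA.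
Qed.
HB.instance Definition _ :=
  GRing.isLinear.Build R {malg R[K]} V _ linear_ext linear_ext_is_linear.

End LinearExtension.

Section Resolution.
Variables (M : locallyGaussianType) (X : {pred M}) (lt : rel M).

Definition generating : Prop :=
  forall m : M, exists2 s : seq M, all [in X] s & m = (\prod_(x <- s) x)%g.

Definition closed_right_lcm : Prop :=
  {in X &, forall x y, has_right_lcm [:: x; y] -> right_lcm [:: x; y] \in X}.

Definition closed_left_complement : Prop :=
  {in X &, forall x y, has_left_lcm [:: x; y] ->
     left_complement x y \in X \/ left_complement x y = 1%g}.

Definition closed_right_complement : Prop :=
  {in X &, forall x y, has_right_lcm [:: x; y] ->
     right_complement x y \in X \/ right_complement x y = 1%g}.

Definition linear_ordering : Prop :=
  [/\ {in X, forall x, ~~ lt x x},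
      {in X & &, transitive lt} &
      {in X &, forall x y, x != y -> lt x y || lt y x}].

Definition is_cell n (A : n.-tuple M) : bool :=
  [&& all [in X] A, pairwise lt A & `[< has_left_lcm A >]].

Definition cell n := {A : n.-tuple M | is_cell A}.

Definition chain n := {malg 'Z[M][cell n]}.

Definition cell_basis n (A : n.-tuple M) : chain n :=
  if insub A is Some c then << (c : cell n) >> else 0.

Definition permute n (a : n.-tuple M) (f : 'S_n) : n.-tuple M :=
  [tuple tnth a (f i) | i < n].

(* [a_1, ..., a_n] for an arbitrary sequence of elements of X and 1 with a
   common left multiple. As 1 is not in X, the terms equal to 1 are covered by
   the second condition. *)
Definition bracket n (a : n.-tuple M) : chain n :=
  if uniq a && all [in X] a then
    if [pick f : 'S_n | pairwise lt (permute a f)] is Some f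
    then (-1) ^+ f *: cell_basis (permute a f) else 0
  else 0.

Definition omit n (A : n.+1.-tuple M) (i : 'I_n.+1) : n.-tuple M :=
  [tuple tnth A (lift i j) | j < n].

Definition omit_complement n (A : n.+1.-tuple M) (i : 'I_n.+1) : n.-tuple M :=
  [tuple left_complement (tnth A (lift i j)) (tnth A i) | j < n].

(* Indices start at 0, whence the exponent i.+1. For n = 0 the left lcm of the
   empty sequence is 1, and the left complement of a_i in it is a_i. *)
Definition boundary_cell n (c : cell n.+1) : chain n :=
  let A := val c in
  \sum_(i < n.+1) (-1) ^+ i.+1 *: bracket (omit_complement A i)
  - \sum_(i < n.+1) (-1) ^+ i.+1 *:
      ((<< left_complement (tnth A i) (left_lcm (omit A i)) >> : 'Z[M])
         *: bracket (omit A i)).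

(* [boundary n] is the map from (n+1)-chains to n-chains. *)
Definition boundary n : {linear chain n.+1 -> chain n} :=
  linear_ext (@boundary_cell n).

(* There is a single 0-cell, the empty one, which is sent to 1. *)
Definition boundary0 : {linear chain 0 -> trivialZ M} :=
  linear_ext (fun _ : cell 0 => (1 : int) : trivialZ M).

End Resolution.

Definition exact_at (R : nzRingType) (U V W : lmodType R)
    (f : {linear U -> V}) (g : {linear V -> W}) : Prop :=
  forall v : V, g v = 0 <-> exists u : U, f u = v.

(* Main.v *)
(* Filter the complex by the end vertex x lcm(A) of a basis element x[A]. All
   terms of d(x[A]) end at that vertex or at a proper left divisor of it, and in
   the graded piece of a vertex z <> 1 one sees the augmented simplex on the set
   of right divisors of z in X, which is contractible. Concretely, choosing a
   right divisor b(z) in X of every z <> 1 gives a homotopy h, sending x[A] to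
   x'[b(z), A] where z = x lcm(A) = x' lcm(b(z), A), such that id - (dh + hd)
   strictly lowers end vertices in positive degree. Left divisibility being well
   founded, this chain map is locally nilpotent, so every cycle is a boundary.
   That d d = 0, and that the boundary of x'[b(z), A] is computed without case
   distinction, rests on the fact that the formula defining d on cells remains
   valid for the extended, possibly degenerate, brackets. *)
Require Import Defs.
From HB Require Import structures.
From mathcomp Require Import all_boot all_order all_fingroup all_algebra.
From mathcomp Require Import zify.
From mathcomp Require Import finmap.
From mathcomp Require Import boolp classical_sets.
From mathcomp.multinomials Require Import monalg.

Set Implicit Arguments.
Unset Strict Implicit.
Unset Printing Implicit Defensive.

Import GRing.Theory Num.Theory.

(** * Left lcms and left complements, studied through left multiples *)

Section LeftMultiples.
Local Open Scope group_scope.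
Variable M : locallyGaussianType.
Implicit Types (x y z m c : M) (s t : seq M).

Lemma left_multiple_refl x : left_multiple x x.
Proof. by exists 1; rewrite mul1g. Qed.

Lemma left_multiple_trans y x z :
  left_multiple z y -> left_multiple y x -> left_multiple z x.
Proof. by move=> [u ->] [v ->]; exists (u * v); rewrite mulgA. Qed.

Lemma left_multiple1 x : left_multiple x 1.
Proof. by exists x; rewrite mulg1. Qed.

Lemma left_multiple_anti x y : left_multiple x y -> left_multiple y x -> x = y.
Proof.
move=> [u xE] [v yE]; suff uv1: u * v = 1.
  by rewrite xE (lg_conical uv1).1 mul1g.
by apply: (@lg_cancelr M x); rewrite -mulgA -yE -xE mul1g.
Qed.

(** Mutual left multiples are equal, since cancellation makes the two quotients mutually inverse and
    1 is the only invertible element. Identities between iterated complements thus reduce to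
    comparing left multiples. *)
Lemma eq_left_multiple x y :
  (forall m, left_multiple m x <-> left_multiple m y) -> x = y.
Proof.
move=> xy; apply: left_multiple_anti.
  exact/xy/left_multiple_refl.
exact/xy/left_multiple_refl.
Qed.

Lemma left_multiple_mul2r x y z :
  left_multiple (x * z) (y * z) <-> left_multiple x y.
Proof.
split=> [[u]|[u ->]]; last by exists u; rewrite mulgA.
by rewrite mulgA => /lg_cancelr ->; exists u.
Qed.

Lemma common_left_multiple_cons x s m :
  common_left_multiple (x :: s) m <->
  left_multiple m x /\ common_left_multiple s m.
Proof.
split=> [sm|[xm sm] y]; last by rewrite inE => /orP[/eqP->|/sm].
by split=> [|y ys]; apply: sm; rewrite inE ?eqxx ?ys ?orbT.
Qed.

Lemma common_left_multiple_pair x y m :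
  common_left_multiple [:: x; y] m <-> left_multiple m x /\ left_multiple m y.
Proof.
rewrite !common_left_multiple_cons; split=> [[? []] //|[? ?]].
by do ?split.
Qed.

Lemma common_left_multiple_mono s m c :
  left_multiple c m -> common_left_multiple s m -> common_left_multiple s c.
Proof. by move=> cm sm x /sm; apply: left_multiple_trans. Qed.

Lemma is_left_lcmP s m :
  is_left_lcm s m <->
  forall c, common_left_multiple s c <-> left_multiple c m.
Proof.
split=> [[sm mP] c|mP].
  by split=> [/mP //|/common_left_multiple_mono]; apply.
by split=> [|c /mP //]; apply/mP/left_multiple_refl.
Qed.

Lemma eq_left_lcm s t :
  (forall c, common_left_multiple s c <-> common_left_multiple t c) ->
  left_lcm s = left_lcm t.
Proof.
move=> st; congr (xget 1 _); apply/seteqP; split=> m /= /is_left_lcmP sm;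
  apply/is_left_lcmP=> c; rewrite -sm; [exact: iff_sym|exact: st].
Qed.

(** Binary lcms are iterated along [s], starting from 1: the bound [m] is a left multiple of both
    [x] and the lcm of the rest. *)
Lemma common_left_multiple_lcm s m :
  common_left_multiple s m -> has_left_lcm s.
Proof.
elim: s m => [|x s IHs] m.
  by exists 1; split=> // c _; apply: left_multiple1.
move=> /common_left_multiple_cons[xm /[dup]/IHs[l /is_left_lcmP lP] /lP lm].
have [|k /is_left_lcmP kP] := @lg_left_lcm M x l.
  by exists m; apply/common_left_multiple_pair.
exists k; apply/is_left_lcmP=> c; rewrite -kP common_left_multiple_pair.
by rewrite common_left_multiple_cons lP.
Qed.

Lemma left_lcmP s m : common_left_multiple s m ->
  forall c, common_left_multiple s c <-> left_multiple c (left_lcm s).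
Proof.
move=> /common_left_multiple_lcm[l sl]; apply/is_left_lcmP.
exact: (@xgetPex _ 1 [set m | is_left_lcm s m]%classic (ex_intro _ l sl)).
Qed.

Lemma left_lcm_multiple s m : common_left_multiple s m ->
  common_left_multiple s (left_lcm s).
Proof. by move=> sm; apply/(left_lcmP sm)/left_multiple_refl. Qed.

Lemma left_complementK x y m : left_multiple m x -> left_multiple m y ->
  left_complement x y * y = left_lcm [:: x; y].
Proof.
move=> mx my; have xym : common_left_multiple [:: x; y] m.
  exact/common_left_multiple_pair.
have /common_left_multiple_pair[_ [z lE]] := left_lcm_multiple xym.
apply: (@xgetPex _ 1 [set z | z * y = left_lcm [:: x; y]]%classic).
by exists z.
Qed.

(** Multiplying by [y] on the right turns this into the universal property of the lcm of [x] and
    [y]; the complement is a residual of [x] by [y]. *)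
Lemma left_complementP x y m : left_multiple m x -> left_multiple m y ->
  forall c, left_multiple c (left_complement x y) <-> left_multiple (c * y) x.
Proof.
move=> mx my c; have xym : common_left_multiple [:: x; y] m.
  exact/common_left_multiple_pair.
rewrite -(left_multiple_mul2r c _ y) (left_complementK mx my) -(left_lcmP xym).
rewrite common_left_multiple_pair; split=> [[]//|]; split=> //.
by exists c.
Qed.

Lemma left_complementx1 x : left_complement x 1 = x.
Proof.
apply: eq_left_multiple => c.
by rewrite (left_complementP (left_multiple_refl x) (left_multiple1 x)) mulg1.
Qed.

Lemma left_complement1x y : left_complement 1 y = 1.
Proof.
apply: eq_left_multiple => c.
rewrite (left_complementP (left_multiple1 y) (left_multiple_refl y)).
by split=> _; apply: left_multiple1.
Qed.

Lemma common_left_multiple_complement s y m : common_left_multiple (y :: s) m ->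
  forall c, common_left_multiple [seq left_complement x y | x <- s] c <->
            common_left_multiple s (c * y).
Proof.
move=> /common_left_multiple_cons[my ms] c; split=> [cP x xs|cP _ /mapP[x xs ->]].
  by apply/(left_complementP (ms x xs) my)/cP/map_f.
exact/(left_complementP (ms x xs) my)/cP.
Qed.

(** This is the cube identity. The left multiples of either side are the [c] such that [x]
    right-divides [c] times the lcm of [y] and [z]. *)
Lemma left_complement_swap x y z m :
  left_multiple m x -> left_multiple m y -> left_multiple m z ->
  left_complement (left_complement x y) (left_complement z y) =
  left_complement (left_complement x z) (left_complement y z).
Proof.
move=> mx my mz; apply: eq_left_multiple => c.
have yz : left_complement y z * z = left_complement z y * y.
  rewrite (left_complementK my mz) (left_complementK mz my).
  by apply: eq_left_lcm => d; rewrite !common_left_multiple_pair; tauto.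
(* The cofactor [u] of that lcm in [m] supplies the common multiples required to form the nested
   complements. *)
have [u mE] : left_multiple m (left_complement z y * y).
  have zym : common_left_multiple [:: z; y] m by apply/common_left_multiple_pair.
  by rewrite (left_complementK mz my); apply/(left_lcmP zym).
have mE' : (u * left_complement y z * z = m) by rewrite -mulgA yz.
rewrite mulgA in mE.
have ux : left_multiple (u * left_complement z y) (left_complement x y).
  by apply/(left_complementP mx my); rewrite -mE.
have uz : left_multiple (u * left_complement y z) (left_complement x z).
  by apply/(left_complementP mx mz); rewrite mE'.
have uy : left_multiple (u * left_complement z y) (left_complement z y).
  by exists u.
have uyz : left_multiple (u * left_complement y z) (left_complement y z).
  by exists u.
have h := iff_trans (left_complementP ux uy c) (left_complementP mx my _).
apply: (iff_trans h); apply: iff_sym.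
apply: (iff_trans (left_complementP uz uyz c)).
apply: (iff_trans (left_complementP mx mz _)).
by rewrite -!mulgA yz.
Qed.

Lemma left_lcm_cons x s m : common_left_multiple (x :: s) m ->
  left_complement x (left_lcm s) * left_lcm s = left_lcm (x :: s).
Proof.
move=> /common_left_multiple_cons[mx ms].
have ml : left_multiple m (left_lcm s) by apply/(left_lcmP ms).
rewrite (left_complementK mx ml); apply: eq_left_lcm => c.
by rewrite common_left_multiple_pair common_left_multiple_cons (left_lcmP ms).
Qed.

Lemma left_lcm_complement s y m : common_left_multiple (y :: s) m ->
  left_lcm [seq left_complement x y | x <- s] * y = left_lcm (y :: s).
Proof.
move=> /[dup] sm /common_left_multiple_cons[[u mE] ms].
have cP := common_left_multiple_complement sm.
have su : common_left_multiple [seq left_complement x y | x <- s] u.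
  by apply/cP; rewrite -mE.
apply: left_multiple_anti.
  apply/(left_lcmP sm)/common_left_multiple_cons; split.
    by exists (left_lcm [seq left_complement x y | x <- s]).
  exact/cP/(left_lcm_multiple su).
have /common_left_multiple_cons[[v lE] sl] := left_lcm_multiple sm.
by rewrite lE left_multiple_mul2r; apply/(left_lcmP su)/cP; rewrite -lE.
Qed.

(** An inaccessible element has an inaccessible proper left divisor, so choice would build an
    infinite descending sequence. *)
Lemma proper_left_divisor_wf : well_founded (@proper_left_divisor M).
Proof.
move=> z0; apply: contrapT => nz0.
have next (p : {z : M | ~ Acc (@proper_left_divisor M) z}) :
    {q : {z : M | ~ Acc (@proper_left_divisor M) z} |
      proper_left_divisor (sval q) (sval p)}.
  apply: cid; case: p => z /= nz; apply: contrapT => zP; apply: nz.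
  constructor=> y yz; apply: contrapT => ny; apply: zP.
  by exists (exist _ y ny).
apply: (@lg_left_noetherian M).
exists (fun n => sval (iter n (fun p => sval (next p)) (exist _ z0 nz0))) => n.
exact: (svalP (next _)).
Qed.

End LeftMultiples.

(** * Removal and permutation of the terms of a tuple *)

Section Tuples.
Variable M : locallyGaussianType.

Lemma common_left_multiple_tuple n (a : n.-tuple M) c :
  common_left_multiple a c <-> forall i, left_multiple c (tnth a i).
Proof.
by split=> [ac i|ac x /tnthP[i ->]//]; apply/ac/mem_tnth.
Qed.

Lemma tnth_omit n (a : n.+1.-tuple M) i j : tnth (omit a i) j = tnth a (lift i j).
Proof. exact: tnth_mktuple. Qed.

Lemma tnth_omit_complement n (a : n.+1.-tuple M) i j :
  tnth (omit_complement a i) j = left_complement (tnth a (lift i j)) (tnth a i).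
Proof. exact: tnth_mktuple. Qed.

Lemma tnth_permute n (a : n.-tuple M) f i : tnth (permute a f) i = tnth a (f i).
Proof. exact: tnth_mktuple. Qed.

Definition tnthE := (tnth_omit, tnth_omit_complement, tnth_permute).

Lemma omit_complementE n (a : n.+1.-tuple M) i :
  omit_complement a i =
  [seq left_complement x (tnth a i) | x <- omit a i] :> seq M.
Proof. by rewrite /= -map_comp. Qed.

Lemma eq_permuteP n (a b : n.-tuple M) :
  reflect (exists f : 'S_n, a = permute b f) (perm_eq a b).
Proof.
apply: (iffP tuple_permP) => -[f fE]; exists f; first exact/val_inj.
by rewrite fE.
Qed.

#[local] Opaque omit omit_complement permute left_lcm left_complement.

Lemma common_left_multiple_omit n (a : n.+1.-tuple M) i c :
  common_left_multiple (tnth a i :: omit a i) c <-> common_left_multiple a c.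
Proof.
rewrite common_left_multiple_cons !common_left_multiple_tuple.
split=> [[ci co] j|ac]; last by split=> // j; rewrite tnthE.
by case: (unliftP i j) => [k|] -> //; have:= co k; rewrite tnthE.
Qed.

Lemma left_lcm_omit n (a : n.+1.-tuple M) i :
  left_lcm (tnth a i :: omit a i) = left_lcm a.
Proof. by apply: eq_left_lcm => c; apply: common_left_multiple_omit. Qed.

Lemma omit_common_left_multiple n (a : n.+1.-tuple M) i c :
  common_left_multiple a c -> common_left_multiple (omit a i) c.
Proof. by move=> /(common_left_multiple_omit a i)/common_left_multiple_cons[]. Qed.

(** Geometrically, the face of [x[a]] that omits [a_i] keeps the end vertex. *)
Lemma left_complement_omit n (a : n.+1.-tuple M) i c :
  common_left_multiple a c ->
  (left_complement (tnth a i) (left_lcm (omit a i)) * left_lcm (omit a i) =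
   left_lcm a)%g.
Proof.
by move=> /(common_left_multiple_omit a i)/left_lcm_cons->; rewrite left_lcm_omit.
Qed.

(** Geometrically, the face divided by [a_i] ends at a left divisor of the end vertex of the cell,
    with quotient [a_i]. This is what lowers end vertices. *)
Lemma left_lcm_omit_complement n (a : n.+1.-tuple M) i c :
  common_left_multiple a c ->
  (left_lcm (omit_complement a i) * tnth a i = left_lcm a)%g.
Proof.
move=> /(common_left_multiple_omit a i)/left_lcm_complement.
by rewrite left_lcm_omit omit_complementE.
Qed.

Lemma omit_complement_common_left_multiple n (a : n.+1.-tuple M) i c :
  common_left_multiple a c ->
  exists d, common_left_multiple (omit_complement a i) d.
Proof.
move=> /(common_left_multiple_omit a i) /[dup] ac /common_left_multiple_cons[].
move=> [d cE] oc; exists d; rewrite omit_complementE.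
by apply/(common_left_multiple_complement ac); rewrite -cE.
Qed.

Lemma permute_perm_eq n (a : n.-tuple M) f : perm_eq (permute a f) a.
Proof. by apply/eq_permuteP; exists f. Qed.

Lemma permuteM n (a : n.-tuple M) f g :
  permute (permute a g) f = permute a (f * g).
Proof. by apply/eq_from_tnth => i; rewrite !tnthE permM. Qed.

Lemma permute_inj n (a : n.-tuple M) : uniq a -> injective (permute a).
Proof.
move=> ua f g /(congr1 (fun t => tnth t)) fg; apply/permP=> i.
by apply: (tuple_uniqP a ua); have:= congr1 (@^~ i) fg; rewrite /= !tnthE.
Qed.

Lemma left_lcm_permute n (a : n.-tuple M) f :
  left_lcm (permute a f) = left_lcm a.
Proof.
apply: eq_left_lcm => c.
by split=> ac x xa; apply: ac; move: xa; rewrite (perm_mem (permute_perm_eq a f)).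
Qed.

(** The factor [s] is the bijection that [f] induces from the positions other than [i] to those
    other than [f i]. *)
Lemma lift_permP n (f : 'S_n.+1) i : exists s, f = lift_perm i (f i) s.
Proof.
have fi j : f i != f (lift i j) by rewrite (inj_eq perm_inj) neq_lift.
pose g j := sval (unlift_some (fi j)).
have gE j : lift (f i) (g j) = f (lift i j).
  by rewrite /g; case: unlift_some => k /=.
have g_inj : injective g.
  move=> j k /(congr1 (lift (f i))); rewrite !gE => /perm_inj.
  exact: lift_inj.
exists (perm g_inj); apply/permP=> k; case: (unliftP i k) => [j|] ->.
  by rewrite lift_perm_lift permE gE.
by rewrite lift_perm_id.
Qed.

Lemma omit_permute n (a : n.+1.-tuple M) i j s :
  omit (permute a (lift_perm i j s)) i = permute (omit a j) s.
Proof.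
by apply/eq_from_tnth => k; rewrite !tnthE lift_perm_lift.
Qed.

Lemma omit_complement_permute n (a : n.+1.-tuple M) i j s :
  omit_complement (permute a (lift_perm i j s)) i = permute (omit_complement a j) s.
Proof.
apply/eq_from_tnth => k.
by rewrite !tnthE lift_perm_lift lift_perm_id.
Qed.

End Tuples.

(** * Extended brackets as signed cells *)

Section Brackets.
Local Open Scope ring_scope.
Variables (M : locallyGaussianType) (X : {pred M}) (lt : rel M).
Hypothesis lt_linear : linear_ordering X lt.

Local Notation bracket := (bracket X lt).
Local Notation cell_basis := (cell_basis X lt).

Lemma pairwise_lt_eq (s t : seq M) : all [in X] s -> perm_eq s t ->
  pairwise lt s -> pairwise lt t -> s = t.
Proof.
move=> sX st; have tX : all [in X] t by rewrite -(perm_all _ st).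
case: lt_linear => lt_irr lt_trans _.
rewrite -!(sorted_pairwise_in lt_trans) // => ss ts.
apply: (irr_sorted_eq_in _ _ ss ts) (perm_mem st) => [x y z xs ys zs|x xs].
  by apply: lt_trans; apply: (allP sX).
by apply/negbTE/lt_irr/(allP sX).
Qed.

Lemma pairwise_lt_permute n (a : n.-tuple M) : all [in X] a -> uniq a ->
  exists f : 'S_n, pairwise lt (permute a f).
Proof.
case: lt_linear => lt_irr lt_trans lt_total aX ua.
(* The sorting lemmas need a total relation, hence the reflexive closure of [lt]; on a tuple without
   repetition, sorted for [le] means increasing for [lt]. *)
pose le x y := (x == y) || lt x y.
have le_total : {in X &, total le}.
  move=> x y xX yX; rewrite /le; case: (eqVneq x y) => //= xy.
  exact: lt_total.
have le_tr : {in X & &, transitive le}.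
  move=> y x z yX xX zX; rewrite /le; case: eqVneq => [->//|_] /= xy.
  by case: (eqVneq y z) => [<-|_] /= => [_|yz]; rewrite ?xy ?(lt_trans y x z) ?orbT.
have pa : perm_eq (sort_tuple le a) a by rewrite perm_sort.
have /eq_permuteP[f fE] := pa; exists f; rewrite -fE.
have sX : all [in X] (sort_tuple le a) by rewrite (perm_all _ pa).
have us : uniq (sort_tuple le a) by rewrite (perm_uniq pa).
have: pairwise le (sort_tuple le a).
  rewrite -(sorted_pairwise_in le_tr) //; exact: sort_sorted_in aX.
move: us; rewrite uniq_pairwise => us ls; have := conj us ls => /andP.
rewrite -pairwise_relI; apply: sub_pairwise => x y /= /andP[].
by rewrite /le => /negbTE->.
Qed.

(** The choice made by [pick] is immaterial: the increasing arrangement is unique, and so is the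
    permutation reaching it when there is no repetition. *)
Lemma bracketE n (a : n.-tuple M) f : all [in X] a -> uniq a ->
  pairwise lt (permute a f) -> bracket a = (-1) ^+ f *: cell_basis (permute a f).
Proof.
move=> aX ua fa; rewrite /Defs.bracket ua aX /=.
case: pickP => [g ga|/(_ f)]; last by rewrite fa.
suff -> : g = f by [].
apply: (permute_inj ua); apply/val_inj; apply: pairwise_lt_eq => //.
  by rewrite (perm_all _ (permute_perm_eq a g)).
by rewrite (permPl (permute_perm_eq a g)) perm_sym permute_perm_eq.
Qed.

Lemma bracket0 n (a : n.-tuple M) : ~~ (uniq a && all [in X] a) -> bracket a = 0.
Proof. by rewrite /Defs.bracket => /negbTE->. Qed.

(** If [g] sorts [a], then [g * f^-1] sorts the permuted tuple into the same cell; in the degenerate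
    case both sides vanish. *)
Lemma bracket_permute n (a : n.-tuple M) f :
  bracket (permute a f) = (-1) ^+ f *: bracket a.
Proof.
have pa := permute_perm_eq a f.
have [/andP[ua aX]|nX] := boolP (uniq a && all [in X] a); last first.
  by rewrite !bracket0 ?scaler0 // (perm_uniq pa) (perm_all _ pa).
have [g ga] := pairwise_lt_permute aX ua.
have gE : permute (permute a f) (g * f^-1)%g = permute a g.
  by rewrite permuteM mulgKV.
have -> : bracket (permute a f) =
    (-1) ^+ (g * f^-1)%g *: cell_basis (permute a g).
  by rewrite -gE; apply: bracketE; rewrite ?gE ?(perm_all _ pa) ?(perm_uniq pa).
have -> : bracket a = (-1) ^+ g *: cell_basis (permute a g) by apply: bracketE.
by rewrite scalerA -signr_addb odd_permM odd_permV addbC.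
Qed.

Lemma bracket_cell n (A : cell X lt n) : bracket (val A) = << A >>.
Proof.
have /and3P[AX Alt _] := valP A.
have p1 : permute (val A) 1 = val A.
  by apply/eq_from_tnth=> i; rewrite tnthE perm1.
have uA : uniq (val A).
  case: lt_linear => lt_irr _ _; move: (Alt) AX.
  elim: {p1 Alt}(tval (val A)) => //= x s IHs.
  move=> /andP[xs ss] /andP[xX sX]; rewrite IHs // andbT; apply/negP => xs'.
  by have := allP xs x xs'; apply/negP/lt_irr.
rewrite (@bracketE _ _ 1) ?p1 // odd_perm1 expr0 scale1r /Defs.cell_basis.
by rewrite valK.
Qed.

Lemma bracket_cellP n (a : n.-tuple M) c :
  uniq a -> all [in X] a -> common_left_multiple a c ->
  exists (A : cell X lt n) (f : 'S_n),
    val A = permute a f /\ bracket a = (-1) ^+ f *: << A >>.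
Proof.
move=> ua aX ac; have [f fa] := pairwise_lt_permute aX ua.
have pa := permute_perm_eq a f.
have cA : is_cell X lt (permute a f).
  rewrite /is_cell (perm_all _ pa) aX fa; apply/asboolP.
  by apply: (@common_left_multiple_lcm _ _ c) => x; rewrite (perm_mem pa) => /ac.
exists (Sub (permute a f) cA), f; split=> //.
by rewrite -bracket_cell SubK bracket_permute scalerA -signr_addb addbb scale1r.
Qed.

End Brackets.

(* [(i, j)] encodes the pair of distinct positions [(i, lift i j)]; the pair
   [(lift i j, swap i j)] encodes it in reverse order. *)
Definition swap n (i : 'I_n.+2) (j : 'I_n.+1) : 'I_n.+1 :=
  odflt j (unlift (lift i j) i).

Lemma lift_swap n (i : 'I_n.+2) j : lift (lift i j) (swap i j) = i.
Proof.
rewrite /swap; have: lift i j != i by rewrite eq_sym neq_lift.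
by case/unlift_some => k iE ->; rewrite /= -iE.
Qed.

Lemma swapK n (i : 'I_n.+2) j : swap (lift i j) (swap i j) = j.
Proof.
apply: (@lift_inj _ i).
by have := lift_swap (lift i j) (swap i j); rewrite (lift_swap i j).
Qed.

(** The parity change produces the cancelling signs in [d d]; the second part says that the
    positions left over are the same in either order of removal. *)
Lemma bump_swap i j k : bump (bump i j) k = i ->
  odd i (+) odd j = ~~ (odd (bump i j) (+) odd k) /\
  forall l, bump (bump i j) (bump k l) = bump i (bump j l).
Proof.
rewrite /bump; have [ij|ij] := leqP i j; have [jk|jk] := leqP _ k => /= kE.
all: by split=> [|l]; lia.
Qed.

Lemma lift_lift_swap n (i : 'I_n.+3) (j : 'I_n.+2) k :
  lift (lift i j) (lift (swap i j) k) = lift i (lift j k).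
Proof.
by apply/val_inj => /=; apply: (bump_swap _).2; have:= congr1 val (lift_swap i j).
Qed.

Lemma linear_ext_basis (R : nzRingType) (K : choiceType) (V : lmodType R)
  (f : K -> V) k : linear_ext f << k >>%R = f k.
Proof.
by rewrite (linear_extEw f msuppU_le) big_seq_fset1 mcoeffUU scale1r.
Qed.

(** * The boundary formula for extended brackets, and [d d = 0] *)

Section Boundary.
Local Open Scope ring_scope.
Variables (M : locallyGaussianType) (X : {pred M}) (lt : rel M).
Hypotheses (lt_linear : linear_ordering X lt) (X1 : 1%g \notin X).
Hypothesis X_complement : closed_left_complement X.

#[local] Opaque Defs.bracket left_complement left_lcm omit omit_complement
  permute.
Local Notation bracket := (bracket X lt).

(** It accepts any tuple, since the tuples produced by complements need be neither increasing nor
    free of repetitions and of 1. *)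
Definition boundary_formula n (a : n.+1.-tuple M) : chain X lt n :=
  \sum_(i < n.+1) (-1) ^+ i.+1 *: bracket (omit_complement a i)
  - \sum_(i < n.+1) (-1) ^+ i.+1 *:
      ((<< left_complement (tnth a i) (left_lcm (omit a i)) >> : 'Z[M])
         *: bracket (omit a i)).

(* The tuples for which the text introduces the extended bracket. *)
Definition admissible n (a : n.-tuple M) : Prop :=
  {in a, forall x, x \in X \/ x = 1%g} /\ exists c, common_left_multiple a c.

(** The coefficients of a chain are ultimately integers, and [int] has no 2-torsion. *)
Lemma chain_eqN n (v : chain X lt n) : v = - v -> v = 0.
Proof.
move=> vN; apply/malgP => A; apply/malgP => m; rewrite !mcoeff0.
have: (v@_A)@_m = - (v@_A)@_m by rewrite {1}vN !mcoeffN.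
by move/eqP; rewrite -addr_eq0 -mulr2n mulrn_eq0 => /eqP.
Qed.

(** Let [s] be what remains of [f] once [i] and its image are removed. The face of [permute a f] at
    [i] is the face of [a] at [f i] permuted by [s], so reindexing along [f] matches the sums. *)
Lemma boundary_formula_permute n (a : n.+1.-tuple M) f :
  boundary_formula (permute a f) = (-1) ^+ f *: boundary_formula a.
Proof.
rewrite /boundary_formula scalerBr.
(* The sign of [f] is the sign of [s] times the parity of [i + f i]. *)
have sgnE i s : f = lift_perm i (f i) s ->
    (-1) ^+ i.+1 * (-1) ^+ s = (-1) ^+ f * (-1) ^+ (f i).+1 :> 'Z[M].
  move=> fE.
  have -> : f = odd i (+) odd (f i) (+) s :> bool by rewrite {1}fE odd_lift_perm.
  rewrite -[(-1) ^+ i.+1]signr_odd -[(-1) ^+ (f i).+1]signr_odd -!signr_addb /=.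
  by congr (_ ^+ nat_of_bool _); case: (odd i) (odd (f i)) (s : bool) => [] [] [].
congr (_ - _).
  rewrite scaler_sumr [RHS](reindex_inj (@perm_inj _ f)).
  apply: eq_bigr => i _.
  have [s fE] := lift_permP f i.
  have -> : omit_complement (permute a f) i = permute (omit_complement a (f i)) s.
    by rewrite -(omit_complement_permute a i) -fE.
  rewrite (bracket_permute lt_linear) scalerA.
  rewrite (sgnE _ _ fE).
  by rewrite -scalerA.
rewrite scaler_sumr [RHS](reindex_inj (@perm_inj _ f)).
apply: eq_bigr => i _.
have [s fE] := lift_permP f i.
have -> : omit (permute a f) i = permute (omit a (f i)) s.
  by rewrite -(omit_permute a i) -fE.
rewrite (bracket_permute lt_linear) left_lcm_permute tnthE.
set u := (<<_>> : 'Z[M]).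
rewrite scalerA scalerA -mulrA (commr_sign u) mulrA (sgnE _ _ fE).
by rewrite -!scalerA.
Qed.

(* The formula is alternating and chains have no 2-torsion. *)
Lemma boundary_formula0 n (a : n.+1.-tuple M) : admissible a ->
  ~~ (uniq a && all [in X] a) -> boundary_formula a = 0.
Proof.
move=> [aX1 [c ac]]; rewrite negb_and => /orP[|/allPn[x xa xX]].
  have [/injectiveP a_inj|/injectivePn[i [j ij aij]] _] :=
    boolP (injectiveb (tnth a)).
    by move/negP=> []; apply/tuple_uniqP.
  (* Transposing the equal entries [i] and [j] fixes the tuple but negates the formula. *)
  apply: chain_eqN; rewrite -scaleN1r -[-1]expr1 -[1%N]/(nat_of_bool true).
  rewrite -ij -odd_tperm -boundary_formula_permute; congr boundary_formula.
  apply/eq_from_tnth=> k; rewrite tnthE.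
  by case: tpermP => // ->.
have x1 : x = 1%g by case: (aX1 x xa) xX => [->|].
have [i iE] := tnthP a x xa; rewrite x1 in iE.
have bracket_1 m (b : m.-tuple M) k : tnth b k = 1%g -> bracket b = 0.
  move=> bk1; apply: bracket0; rewrite negb_and; apply/orP; right.
  by apply/allPn; exists (tnth b k); rewrite ?mem_tnth ?bk1.
rewrite /boundary_formula.
(* When the entry at [i] is 1, every face at another position still contains 1 and vanishes, while
   the two faces at [i] coincide and cancel. *)
rewrite [X in X - _](bigD1 i isT) [X in _ - X](bigD1 i isT).
rewrite [X in _ + X - _]big1; last first.
  move=> j /= /unlift_some[k ik _].
  rewrite (bracket_1 _ _ k) ?scaler0 //.
  by rewrite tnthE -ik -iE left_complement1x.
rewrite [X in _ - (_ + X)]big1; last first.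
  move=> j /= /unlift_some[k ik _].
  rewrite (bracket_1 _ _ k) ?scaler0 //.
  by rewrite tnthE -ik -iE.
have -> : omit_complement a i = omit a i.
  by apply/eq_from_tnth=> k; rewrite !tnthE -iE left_complementx1.
have one : << 1%g >> = 1 :> 'Z[M] by [].
by rewrite -iE left_complement1x one scale1r addr0 subrr.
Qed.

Lemma boundary_cellE n (A : cell X lt n.+1) :
  boundary X lt n << A >> = boundary_formula (val A).
Proof.
exact: linear_ext_basis.
Qed.

(** Both sides alternate, so a nondegenerate tuple may be sorted into a cell; on degenerate ones
    both vanish. *)
Lemma boundary_bracket n (a : n.+1.-tuple M) : admissible a ->
  boundary X lt n (bracket a) = boundary_formula a.
Proof.
move=> /[dup] aA [_ [c ac]].
have [/andP[ua aX]|nX] := boolP (uniq a && all [in X] a); last first.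
  by rewrite bracket0 // linear0 boundary_formula0.
have [A [f [AE ->]]] := bracket_cellP lt_linear ua aX ac.
rewrite linearZ /= boundary_cellE AE boundary_formula_permute.
by rewrite scalerA -signr_addb addbb scale1r.
Qed.

Lemma admissible_omit n (a : n.+1.-tuple M) i :
  admissible a -> admissible (omit a i).
Proof.
move=> [aX [c ac]]; split; last by exists c; apply: omit_common_left_multiple.
by move=> _ /mapP[j _ ->]; apply/aX/mem_tnth.
Qed.

(** Closure of [X] under left complement enters here. *)
Lemma admissible_omit_complement n (a : n.+1.-tuple M) i :
  admissible a -> admissible (omit_complement a i).
Proof.
move=> [aX [c ac]]; split; last exact: omit_complement_common_left_multiple ac.
move=> _ /mapP[j _ ->].
have [kX|->] := aX _ (mem_tnth (lift i j) a); last first.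
  by right; apply: left_complement1x.
have [iX|->] := aX _ (mem_tnth i a); last by left; rewrite left_complementx1.
apply: X_complement => //; apply: (@common_left_multiple_lcm _ _ c).
by apply/common_left_multiple_pair; split; apply/ac/mem_tnth.
Qed.

(** Reversing pairs is an involution of the index set, so the sum equals its own opposite. *)
Lemma sum_swap0 n (F : 'I_n.+2 -> 'I_n.+1 -> chain X lt n) :
  (forall i j, F (lift i j) (swap i j) = - F i j) ->
  \sum_(i < n.+2) \sum_(j < n.+1) F i j = 0.
Proof.
move=> FN; apply: chain_eqN; rewrite pair_bigA /=.
pose sw (p : 'I_n.+2 * 'I_n.+1) := (lift p.1 p.2, swap p.1 p.2).
have swK : involutive sw by case=> i j; rewrite /sw /= lift_swap swapK.
rewrite [LHS](reindex_inj (inv_inj swK)) -sumrN.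
by apply: eq_bigr => -[i j] _; apply: FN.
Qed.

Lemma malgUM (x y : M) : << x >> * << y >> = << (x * y)%g >> :> 'Z[M].
Proof. by rewrite malgM_def fgmulUU mulr1. Qed.

Lemma omit_swap n (a : n.+2.-tuple M) i j :
  omit (omit a (lift i j)) (swap i j) = omit (omit a i) j.
Proof.
case: n a i j => [|n] a i j; first by rewrite [LHS]tuple0 [RHS]tuple0.
by apply/eq_from_tnth => k; rewrite !tnthE lift_lift_swap.
Qed.

Lemma omit_complement_swap n (a : n.+2.-tuple M) i j c :
  common_left_multiple a c ->
  omit_complement (omit_complement a (lift i j)) (swap i j) =
  omit_complement (omit_complement a i) j.
Proof.
move=> /common_left_multiple_tuple ac.
case: n a i j ac => [|n] a i j ac; first by rewrite [LHS]tuple0 [RHS]tuple0.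
apply/eq_from_tnth => k; rewrite !tnthE lift_lift_swap lift_swap.
exact: left_complement_swap.
Qed.

Lemma omit_omit_complement n (a : n.+2.-tuple M) i j :
  omit (omit_complement a (lift i j)) (swap i j) =
  omit_complement (omit a i) j.
Proof.
case: n a i j => [|n] a i j; first by rewrite [LHS]tuple0 [RHS]tuple0.
by apply/eq_from_tnth => k; rewrite !tnthE lift_lift_swap.
Qed.

(** Multiplied on the right by the lcm of [omit a i], both sides become the lcm of [a]. *)
Lemma left_complement_omit_complement n (a : n.+2.-tuple M) i j c :
  common_left_multiple a c ->
  left_complement (tnth (omit_complement a (lift i j)) (swap i j))
    (left_lcm (omit (omit_complement a (lift i j)) (swap i j))) =
  left_complement (tnth a i) (left_lcm (omit a i)).
Proof.
move=> ac; have [d acd] := omit_complement_common_left_multiple (lift i j) ac.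
have ao := omit_common_left_multiple (i := i) ac.
apply: (@lg_cancelr M (left_lcm (omit a i))).
rewrite (left_complement_omit i ac).
have <- := left_lcm_omit_complement j ao.
rewrite -omit_omit_complement mulgA (left_complement_omit _ acd).
by rewrite tnthE (left_lcm_omit_complement _ ac).
Qed.

Lemma sign_swap (R : nzRingType) n (i : 'I_n.+2) j :
  (-1) ^+ (lift i j + swap i j) = - (-1) ^+ (i + j) :> R.
Proof.
rewrite -signr_odd -[in RHS]signr_odd (oddD (lift i j)) (oddD i).
have [-> _] := bump_swap (congr1 val (lift_swap i j)).
by rewrite signrN opprK.
Qed.

Lemma left_complement_omit_omit n (a : n.+2.-tuple M) i j c :
  common_left_multiple a c ->
  (left_complement (tnth a (lift i j)) (left_lcm (omit a (lift i j))) *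
   left_complement (tnth (omit a (lift i j)) (swap i j))
     (left_lcm (omit (omit a (lift i j)) (swap i j))) =
   left_complement (tnth a i) (left_lcm (omit a i)) *
   left_complement (tnth (omit a i) j) (left_lcm (omit (omit a i) j)))%g.
Proof.
move=> ac; apply: (@lg_cancelr M (left_lcm (omit (omit a i) j))).
have ao := omit_common_left_multiple (i := i) ac.
have ao' := omit_common_left_multiple (i := lift i j) ac.
have e := left_complement_omit j ao.
have e' := left_complement_omit (swap i j) ao'.
rewrite omit_swap in e' *.
apply: etrans (esym (mulgA _ _ _)) _; apply: etrans _ (mulgA _ _ _).
apply: etrans (congr1 (mulg _) e') _; apply: etrans _ (esym (congr1 (mulg _) e)).
exact: etrans (left_complement_omit _ ac) (esym (left_complement_omit _ ac)).
Qed.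

Lemma subrACA (V : zmodType) (x y z t : V) : x - y - (z - t) = x - z - (y - t).
Proof. by rewrite !opprB addrACA [RHS]addrACA [- z - y]addrC. Qed.

Lemma linear_signed_difference (R : nzRingType) (U V : lmodType R)
    (f : {linear U -> V}) (s w : R) (x y : U) :
  f (s *: (x - w *: y)) = s *: (f x - w *: f y).
Proof. by rewrite linearZ linearB linearZ. Qed.

Lemma signed_sum_difference (R : nzRingType) (V : lmodType R) n i (w : R)
    (x y : 'I_n -> V) :
  (-1) ^+ i.+1 *: (\sum_(j < n) (-1) ^+ j.+1 *: x j
                   - w *: \sum_(j < n) (-1) ^+ j.+1 *: y j) =
  \sum_(j < n) (-1) ^+ (i + j) *: (x j - w *: y j).
Proof.
rewrite scaler_sumr -sumrB scaler_sumr; apply: eq_bigr => j _.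
rewrite [w *: _]scalerA commr_sign -[_ *: y j]scalerA -scalerBr scalerA.
by rewrite -exprD addSn addnS !exprS !mulN1r opprK.
Qed.

Lemma boundary_formulaE n (a : n.+1.-tuple M) :
  boundary_formula a = \sum_(i < n.+1) (-1) ^+ i.+1 *:
    (bracket (omit_complement a i)
     - (<< left_complement (tnth a i) (left_lcm (omit a i)) >> : 'Z[M])
         *: bracket (omit a i)).
Proof.
by rewrite /boundary_formula -sumrB; apply: eq_bigr => i _; rewrite scalerBr.
Qed.

(** For an ordered pair of positions, [F] collects the four terms obtained by dividing by or
    omitting each entry. Reversing the pair fixes the first and last terms, exchanges the two mixed
    ones, and changes the sign in front. *)
Lemma boundary_boundary_formula n (a : n.+2.-tuple M) : admissible a ->
  boundary X lt n (boundary_formula a) = 0.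
Proof.
move=> /[dup] aA [_ [c ac]].
pose w m (b : m.+1.-tuple M) i : 'Z[M] :=
  << left_complement (tnth b i) (left_lcm (omit b i)) >>.
pose F i j := bracket (omit_complement (omit_complement a i) j)
  - w _ (omit_complement a i) j *: bracket (omit (omit_complement a i) j)
  - (w _ a i *: bracket (omit_complement (omit a i) j)
    - w _ a i *: (w _ (omit a i) j *: bracket (omit (omit a i) j))).
have T23 i j : w _ (omit_complement a (lift i j)) (swap i j) *:
      bracket (omit (omit_complement a (lift i j)) (swap i j)) =
    w _ a i *: bracket (omit_complement (omit a i) j).
  by rewrite /w (left_complement_omit_complement i j ac) omit_omit_complement.
have T4 i j : w _ a (lift i j) *: (w _ (omit a (lift i j)) (swap i j) *:
      bracket (omit (omit a (lift i j)) (swap i j))) =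
    w _ a i *: (w _ (omit a i) j *: bracket (omit (omit a i) j)).
  apply: etrans (scalerA _ _ _) _; apply: etrans _ (esym (scalerA _ _ _)).
  refine (f_equal2 *:%R _ (congr1 _ (omit_swap a i j))).
  apply: etrans (malgUM _ _) _; apply: etrans _ (esym (malgUM _ _)).
  by have -> := left_complement_omit_omit i j ac.
have FE i j : F (lift i j) (swap i j) = F i j.
  (* The same identity for the reversed pair identifies the other mixed term. *)
  have T23' := T23 (lift i j) (swap i j); rewrite lift_swap swapK in T23'.
  have e := congr1 (fun b => bracket b) (omit_complement_swap i j ac).
  pose sub u v : chain X lt n := u - v.
  apply: etrans (subrACA _ _ _ _).
  have e' := f_equal2 sub (esym T23') (T4 i j).
  exact: (f_equal2 sub (f_equal2 sub e (T23 i j)) e').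
have -> : boundary X lt n (boundary_formula a) =
    \sum_(i < n.+2) \sum_(j < n.+1) (-1) ^+ (i + j) *: F i j.
  rewrite boundary_formulaE; apply: etrans (linear_sum _ _ _ _) _.
  apply: eq_bigr => i _; apply: etrans (linear_signed_difference _ _ _ _ _) _.
  have dc := boundary_bracket (admissible_omit_complement i aA).
  have d_o := boundary_bracket (admissible_omit i aA).
  rewrite boundary_formulaE in dc; rewrite boundary_formulaE in d_o.
  apply: etrans (congr1 _ (f_equal2 (fun u v => u - w _ a i *: v) dc d_o)) _.
  apply: etrans (signed_sum_difference _ _ _ _) _.
  apply: eq_bigr => j _; refine (congr1 _ (congr1 _ (congr1 _ _))).
  exact: scalerBr.
apply: sum_swap0 => i j.
exact: etrans (f_equal2 *:%R (sign_swap _ i j) (FE i j)) (scaleNr _ _).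
Qed.

End Boundary.

(** * Additive extension from the elements [x[A]] *)

Section AdditiveExtension.
Local Open Scope ring_scope.
Variables (M K : choiceType) (V : zmodType) (f : M -> K -> V).

(** A chain is viewed as an integer combination of elements [x[A]], because the homotopy depends on
    the end vertex [x lcm(A)] and need not be linear over the monoid ring. *)
Definition additive_ext (v : {malg {malg int[M]}[K]}) : V :=
  \sum_(A <- msupp v) linear_ext (fun x => f x A : zmodule V) v@_A.

Lemma additive_extEw (D : {fset K}) (v : {malg {malg int[M]}[K]}) :
  (msupp v `<=` D)%fset ->
  additive_ext v = \sum_(A <- D) linear_ext (fun x => f x A : zmodule V) v@_A.
Proof.
move=> vD; rewrite /additive_ext (big_fset_incl _ vD) // => A _ Av.
by rewrite mcoeff_outdom // linear0.
Qed.

Fact additive_ext_is_additive : zmod_morphism additive_ext.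
Proof.
move=> u v; pose D := (msupp u `|` msupp v `|` msupp (u - v))%fset.
rewrite !(@additive_extEw D) /D ?fsubsetUr //; first last.
- by rewrite -fsetUA fsubsetUl.
- by rewrite fsubsetU // fsubsetUr.
rewrite -sumrB; apply: eq_bigr => A _.
by rewrite mcoeffB linearB.
Qed.
HB.instance Definition _ :=
  GRing.isZmodMorphism.Build {malg {malg int[M]}[K]} V additive_ext
    additive_ext_is_additive.

Lemma additive_ext_basis x A : additive_ext << << x >> *g A >> = f x A.
Proof.
rewrite (additive_extEw msuppU_le) big_seq_fset1 mcoeffUU.
exact: (linear_ext_basis (fun x => f x A : zmodule V)).
Qed.

End AdditiveExtension.

Section Chains.
Local Open Scope ring_scope.

Lemma malg_scale_basis (R : nzRingType) (K : choiceType) (c : R) (k : K) :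
  c *: << k >> = << c *g k >> :> {malg R[K]}.
Proof. by apply/malgP => l; rewrite mcoeffZ !mcoeffU mulr_natr. Qed.

Lemma malg_basis_sum (R : nzRingType) (K : choiceType) (v : {malg R[K]}) :
  v = \sum_(k <- msupp v) v@_k *: << k >>.
Proof.
by rewrite [LHS]monalgE; apply: eq_bigr => k _; rewrite malg_scale_basis.
Qed.

Lemma malg_linear_comp0 (R : nzRingType) (K : choiceType) (V W : lmodType R)
    (f : {linear {malg R[K]} -> V}) (g : {linear V -> W}) :
  (forall k, g (f << k >>) = 0) -> forall v, g (f v) = 0.
Proof.
move=> gf0 v; rewrite [v]malg_basis_sum (linear_sum f) (linear_sum g).
by rewrite big1 // => k _; rewrite linearZ linearZ /= gf0 scaler0.
Qed.

(** An integer coefficient is an iterated sum, up to sign, so the elements [x[A]] generate chains as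
    an abelian group. *)
Lemma malg_add_ind (M K : choiceType) (P : {malg {malg int[M]}[K]} -> Prop) :
  P 0 -> (forall u v, P u -> P v -> P (u - v)) ->
  (forall x A, P << << x >> *g A >>) -> forall v, P v.
Proof.
move=> P0 PB Pe v; have PN u : P u -> P (- u) by rewrite -sub0r; apply: PB.
have PD u w : P u -> P w -> P (u + w).
  by move=> Pu Pw; rewrite -[w]opprK; apply/PB/PN.
have Pz x A (c : int) : P << << c *g x >> *g A >>.
  have -> : << << c *g x >> *g A >> = << << x >> *g A >> *~ c
      :> {malg {malg int[M]}[K]}.
    have -> : << c *g x >> = << x >> *~ c :> {malg int[M]}.
      by rewrite -raddfMz /= intz.
    by rewrite raddfMz.
  have Pn (n : nat) : P (<< << x >> *g A >> *+ n).
    by elim: n => [|n IHn]; rewrite ?mulr0n // mulrS; apply: PD.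
  by case: c => n; [exact: Pn|rewrite NegzE mulrNz; apply/PN/Pn].
rewrite [v]monalgE; apply: (big_ind P) => // A _.
rewrite [X in << X *g A >>]monalgE raddf_sum.
by apply: (big_ind P) => // x _; apply: Pz.
Qed.

Lemma scale_signr_morph (R : nzRingType) (U V : lmodType R)
    (f : {additive U -> V}) k x : f ((-1) ^+ k *: x) = (-1) ^+ k *: f x.
Proof.
rewrite -signr_odd; case: odd; rewrite ?expr0 ?scale1r // expr1 !scaleN1r.
exact: raddfN.
Qed.

End Chains.

(** * The cone homotopy and its residue *)

Section Contraction.
Local Open Scope ring_scope.
Variables (M : locallyGaussianType) (X : {pred M}) (lt : rel M).
Hypotheses (X_generating : generating X) (X1 : 1%g \notin X).
Hypothesis X_complement : closed_left_complement X.
Hypothesis lt_linear : linear_ordering X lt.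

#[local] Opaque Defs.bracket left_complement left_lcm omit omit_complement
  permute.
Local Notation bracket := (bracket X lt).

(* There is no right divisor of [1] in [X], whence the default value [1]. *)
Definition generator_of (z : M) : M :=
  xget 1%g [set b | b \in X /\ left_multiple z b]%classic.

Definition left_quotient (z y : M) : M := xget 1%g [set q | q * y = z]%g%classic.

Lemma left_quotientK (z y : M) :
  left_multiple z y -> (left_quotient z y * y = z)%g.
Proof.
move=> [q zE]; rewrite /left_quotient; case: xgetP => [u -> //|/(_ q)].
by rewrite /= -zE.
Qed.

Lemma generator_ofP z : z != 1%g ->
  generator_of z \in X /\ left_multiple z (generator_of z).
Proof.
move=> z1; rewrite /generator_of; case: xgetP => [u -> //|nP]; exfalso.
have [s sX zE] := X_generating z.
(* The last letter of a word for [z] over [X] is a right divisor of [z]. *)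
case/lastP: s => [|s b] in sX zE; first by rewrite zE big_nil eqxx in z1.
apply: (nP b); split; first by apply: (allP sX); rewrite mem_rcons mem_head.
by exists (\prod_(x <- s) x)%g; rewrite zE -cats1 big_cat big_seq1.
Qed.

Lemma generator_of1 : generator_of 1%g = 1%g.
Proof.
rewrite /generator_of; case: xgetP => [b -> [bX [u /esym/lg_conical[_ b1]]]|//].
by rewrite b1.
Qed.

Lemma generator_of_multiple z : left_multiple z (generator_of z).
Proof.
have [->|/generator_ofP[]//] := eqVneq z 1%g.
rewrite generator_of1; exact: left_multiple1.
Qed.

Lemma generator_ofX z : generator_of z \in X \/ generator_of z = 1%g.
Proof.
by have [->|/generator_ofP[]] := eqVneq z 1%g; [right; exact: generator_of1|left].
Qed.

Lemma cone_common_left_multiple n (x : M) (a : n.-tuple M) c :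
  common_left_multiple a c -> let z := (x * left_lcm a)%g in
  common_left_multiple [tuple of generator_of z :: a] z.
Proof.
move=> ac z; apply/common_left_multiple_cons; split.
  exact: generator_of_multiple.
by apply/(left_lcmP ac); exists x.
Qed.

Lemma cone_multiple n (x : M) (a : n.-tuple M) : admissible X a ->
  let z := (x * left_lcm a)%g in
  left_multiple z (left_lcm [tuple of generator_of z :: a]).
Proof.
move=> [_ [c ac]] z; have zb := cone_common_left_multiple (x := x) ac.
exact/(left_lcmP zb).
Qed.

Lemma admissible_cone n (x : M) (a : n.-tuple M) : admissible X a ->
  admissible X [tuple of generator_of (x * left_lcm a)%g :: a].
Proof.
move=> [aX [c ac]]; split.
  by move=> y; rewrite inE => /orP[/eqP->|/aX//]; apply: generator_ofX.
by exists (x * left_lcm a)%g; apply: cone_common_left_multiple ac.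
Qed.

(** The left quotient moves the starting point so that the enlarged cell still ends at [z]. *)
Definition cone n (x : M) (a : n.-tuple M) : chain X lt n.+1 :=
  let z := (x * left_lcm a)%g in
  let b := [tuple of generator_of z :: a] in
  (<< left_quotient z (left_lcm b) >> : 'Z[M]) *: bracket b.

Definition homotopy n : chain X lt n -> chain X lt n.+1 :=
  additive_ext (fun x (A : cell X lt n) => cone x (val A)).

Fact homotopy_is_additive n : zmod_morphism (@homotopy n).
Proof. exact: additive_ext_is_additive. Qed.
HB.instance Definition _ n := GRing.isZmodMorphism.Build
  (chain X lt n) (chain X lt n.+1) (@homotopy n) (@homotopy_is_additive n).

(** The homotopy is defined on cells only. The formula extends because the cone is alternating in
    [a] and is degenerate whenever [a] is. *)
Lemma homotopy_bracket n (x : M) (a : n.-tuple M) : admissible X a ->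
  homotopy ((<< x >> : 'Z[M]) *: bracket a) = cone x a.
Proof.
move=> [_ [c ac]].
have [/andP[ua aX]|nX] := boolP (uniq a && all [in X] a); last first.
  rewrite bracket0 // scaler0 raddf0 /cone bracket0 ?scaler0 //=.
  by apply: contra nX => /andP[/andP[_ ->] /andP[_ ->]].
have [A [f [AE ->]]] := bracket_cellP lt_linear ua aX ac.
rewrite scalerA commr_sign -scalerA malg_scale_basis.
rewrite scale_signr_morph /= /homotopy additive_ext_basis AE.
rewrite /cone left_lcm_permute.
set b := generator_of _.
(* Keeping the apex fixed extends [f] to a permutation of the cone, with the same sign. *)
have -> : [tuple of b :: permute a f] =
    permute [tuple of b :: a] (lift_perm 0 0 f).
  apply/eq_from_tnth => i; rewrite tnth_permute.
  have [j|] := unliftP 0 i => ->.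
    by rewrite lift_perm_lift !tnthS tnth_permute.
  by rewrite lift_perm_id !tnth0.
rewrite left_lcm_permute (bracket_permute lt_linear) odd_lift_perm addbb addFb.
by rewrite scalerA scalerA -mulrA commr_sign mulrA -signr_addb addbb mul1r.
Qed.

(* This would vanish if [homotopy] were a contraction; it only strictly lowers
   end vertices. *)
Definition residue n (v : chain X lt n.+1) : chain X lt n.+1 :=
  v - boundary X lt n.+1 (homotopy v) - homotopy (boundary X lt n v).

Lemma zmod_morphism_residue (U V W : zmodType) (d : {additive V -> U})
    (d' : {additive W -> V}) (h : {additive V -> W}) (h' : {additive U -> V}) :
  zmod_morphism (fun v => v - d' (h v) - h' (d v)).
Proof.
move=> u v; rewrite (raddfB h) (raddfB d') (raddfB d) (raddfB h').
by rewrite (subrACA u v) [LHS]subrACA.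
Qed.

Fact residue_is_additive n : zmod_morphism (@residue n).
Proof.
exact: (zmod_morphism_residue (boundary X lt n) (boundary X lt n.+1)
  (@homotopy n.+1) (@homotopy n)).
Qed.
HB.instance Definition _ n := GRing.isZmodMorphism.Build
  (chain X lt n.+1) (chain X lt n.+1) (@residue n) (@residue_is_additive n).

Section SignedSums.
Variables (R : nzRingType) (V : lmodType R).

Lemma scale_signed_sum n (c : R) (x y : 'I_n -> V) :
  c *: (\sum_(i < n) (-1) ^+ i.+1 *: (x i - y i)) =
  \sum_(i < n) (-1) ^+ i.+1 *: (c *: x i - c *: y i).
Proof.
rewrite scaler_sumr; apply: eq_bigr => i _.
by rewrite scalerA commr_sign -scalerA scalerBr.
Qed.

Lemma scale_signed_sum_recl n (c : R) (x y : 'I_n.+1 -> V) :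
  c *: (\sum_(i < n.+1) (-1) ^+ i.+1 *: (x i - y i)) =
  \sum_(i < n) (-1) ^+ i *: (c *: x (lift 0 i) - c *: y (lift 0 i))
  - (c *: x 0 - c *: y 0).
Proof.
rewrite scale_signed_sum big_ord_recl addrC expr1 scaleN1r; congr (_ - _).
by apply: eq_bigr => i _; rewrite !exprS !mulN1r opprK.
Qed.

(** This is the bookkeeping of [id - dh - hd]: [e] is the cell, [s] and [x] are the divided faces of
    its cone, [z] the images under [h] of its divided faces, and [y] the cones over its other faces,
    which occur in both [dh] and [hd] and cancel. *)
Lemma signed_sum_telescope n (e s : V) (x y z : 'I_n -> V) :
  e - (\sum_(i < n) (-1) ^+ i *: (x i - y i) - (s - e))
    - \sum_(i < n) (-1) ^+ i.+1 *: (z i - y i) =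
  s - \sum_(i < n) (-1) ^+ i *: (x i - z i).
Proof.
rewrite opprB addrA [e + _]addrC subrK -addrA -opprD; congr (_ - _).
rewrite -big_split; apply: eq_bigr => i _ /=.
by rewrite exprS mulN1r scaleNr -scalerBr opprB addrA subrK.
Qed.

End SignedSums.

Lemma raddf_signed_sum (R : nzRingType) (U V : lmodType R)
    (f : {additive U -> V}) n (c : R) (x y : 'I_n -> U) :
  f (c *: (\sum_(i < n) (-1) ^+ i.+1 *: (x i - y i))) =
  \sum_(i < n) (-1) ^+ i.+1 *: (f (c *: x i) - f (c *: y i)).
Proof.
rewrite scale_signed_sum raddf_sum; apply: eq_bigr => i _.
by rewrite scale_signr_morph raddfB.
Qed.

(** * Faces of a cone *)

Section Cone.
Variables (n : nat) (x : M) (a : n.+1.-tuple M).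
Hypothesis aA : admissible X a.
Let z := (x * left_lcm a)%g.
Let b := [tuple of generator_of z :: a].
Let q := left_quotient z (left_lcm b).

Lemma cone_quotientK : (q * left_lcm b = z)%g.
Proof.
exact: left_quotientK (cone_multiple x aA).
Qed.

Lemma omit_cone0 : omit b 0 = a.
Proof. by apply/eq_from_tnth => i; rewrite tnth_omit tnthS. Qed.

Lemma omit_cone_lift i :
  omit b (lift 0 i) = [tuple of generator_of z :: omit a i].
Proof.
apply/eq_from_tnth => k; rewrite tnth_omit; have [j|] := unliftP 0 k => ->.
  have -> : lift (lift 0 i) (lift 0 j) = lift 0 (lift i j).
    by apply/val_inj; rewrite /= /bump; lia.
  by rewrite !tnthS tnth_omit.
have -> : lift (lift 0 i) 0 = 0 by apply/val_inj.
by rewrite !tnth0.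
Qed.

(** The face opposite the apex is the original cell: [q] times its coefficient agrees with [x] after
    multiplication by the lcm of [a]. *)
Lemma cone_bottom :
  << q >> *: (<< left_complement (tnth b 0) (left_lcm (omit b 0)) >> *:
              bracket (omit b 0)) = << x >> *: bracket a :> chain X lt n.+1.
Proof.
have [_ [c bc]] := admissible_cone x aA.
have e : (q * left_complement (tnth b 0) (left_lcm (omit b 0)) = x)%g.
  apply: (@lg_cancelr M (left_lcm (omit b 0))).
  rewrite -mulgA (left_complement_omit 0 bc) cone_quotientK.
  by rewrite /z -[in LHS]omit_cone0.
have e' := malgUM q (left_complement (tnth b 0) (left_lcm (omit b 0))).
rewrite e in e'; apply: etrans (scalerA _ _ _) _.
refine (f_equal2 *:%R e' (congr1 _ omit_cone0)).
Qed.

(** The undivided face of [x[a]] at [i] still ends at [z], so its cone has the same apex; the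
    coefficients agree by right cancellation. *)
Lemma cone_side i :
  << q >> *:
    (<< left_complement (tnth b (lift 0 i)) (left_lcm (omit b (lift 0 i))) >>
      *: bracket (omit b (lift 0 i))) =
  cone (x * left_complement (tnth a i) (left_lcm (omit a i)))%g (omit a i).
Proof.
have [_ [c ac]] := aA; have [_ [d bd]] := admissible_cone x aA.
have zE : (x * left_complement (tnth a i) (left_lcm (omit a i)) *
           left_lcm (omit a i) = z)%g.
  by rewrite -mulgA (left_complement_omit i ac).
have e : (q * left_complement (tnth b (lift 0 i)) (left_lcm (omit b (lift 0 i))) *
           left_lcm (omit b (lift 0 i)) = z)%g.
  by rewrite -mulgA (left_complement_omit (lift 0 i) bd) cone_quotientK.
have -> : cone (x * left_complement (tnth a i) (left_lcm (omit a i)))%g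
      (omit a i) =
    << left_quotient z (left_lcm (omit b (lift 0 i))) >> *:
      bracket (omit b (lift 0 i)).
  by rewrite /cone zE -omit_cone_lift.
have e' := malgUM q
  (left_complement (tnth b (lift 0 i)) (left_lcm (omit b (lift 0 i)))).
have e'' : (q *
      left_complement (tnth b (lift 0 i)) (left_lcm (omit b (lift 0 i))) =
    left_quotient z (left_lcm (omit b (lift 0 i))))%g.
  apply: (@lg_cancelr M (left_lcm (omit b (lift 0 i)))).
  by rewrite e left_quotientK // -e; eexists.
rewrite e'' in e'; apply: etrans (scalerA _ _ _) _.
refine (f_equal2 *:%R e' (erefl _)).
Qed.

(** The undivided faces of the cone cancel: the one opposite the apex against the cell, the others
    against cones in [hd]. Only terms from divided faces remain. *)
Lemma residue_bracket :
  residue ((<< x >> : 'Z[M]) *: bracket a) =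
  << q >> *: bracket (omit_complement b 0)
  - \sum_(i < n.+1) (-1) ^+ i *:
      (<< q >> *: bracket (omit_complement b (lift 0 i))
       - homotopy ((<< x >> : 'Z[M]) *: bracket (omit_complement a i))).
Proof.
apply: etrans (signed_sum_telescope _ _ _
  (fun i =>
     cone (x * left_complement (tnth a i) (left_lcm (omit a i)))%g (omit a i))
  _).
rewrite /residue; refine (f_equal2 (fun u v => _ - u - v) _ _).
  have bA := admissible_cone x aA.
  apply: etrans (congr1 (boundary X lt n.+1) (homotopy_bracket x aA)) _.
  apply: etrans (linearZ _ _) _.
  have e := boundary_bracket lt_linear X1 bA; rewrite boundary_formulaE in e.
  apply: etrans (congr1 _ e) _; apply: etrans (scale_signed_sum_recl _ _ _) _.
  refine (f_equal2 (fun u v => u - (_ - v)) _ cone_bottom).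
  apply: eq_bigr => i _; refine (congr1 _ (congr1 _ (congr1 _ _))).
  exact: cone_side.
have e := boundary_bracket lt_linear X1 aA; rewrite boundary_formulaE in e.
apply: etrans (congr1 _ (etrans (linearZ _ _) (congr1 _ e))) _.
apply: etrans (raddf_signed_sum _ _ _ _) _.
apply: eq_bigr => i _; refine (congr1 _ (congr1 _ (congr1 _ _))).
apply: etrans (homotopy_bracket _ (admissible_omit i aA)).
refine (congr1 _ (etrans (scalerA _ _ _) _)).
refine (f_equal2 *:%R (malgUM _ _) (erefl _)).
Qed.

End Cone.

(** * Local nilpotence of the residue, and exactness in positive degrees *)

Definition residue_nilpotent n (v : chain X lt n.+1) : Prop :=
  exists k, iter k (@residue n) v = 0.

Lemma iter_residueB n k (u v : chain X lt n.+1) :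
  iter k (@residue n) (u - v) = iter k (@residue n) u - iter k (@residue n) v.
Proof. by elim: k => //= k ->; rewrite raddfB. Qed.

Lemma residue_nilpotent0 n : residue_nilpotent (0 : chain X lt n.+1).
Proof. by exists 0%N. Qed.

Lemma residue_nilpotentB n (u v : chain X lt n.+1) :
  residue_nilpotent u -> residue_nilpotent v -> residue_nilpotent (u - v).
Proof.
have iter0 k : iter k (@residue n) 0 = 0 by elim: k => //= k ->; rewrite raddf0.
move=> [k uk] [l vl]; exists (k + l)%N.
by rewrite iter_residueB [in X in X - _]addnC !iterD uk vl !iter0 subrr.
Qed.

Lemma residue_nilpotentN n (v : chain X lt n.+1) :
  residue_nilpotent v -> residue_nilpotent (- v).
Proof. by rewrite -sub0r; apply/residue_nilpotentB/residue_nilpotent0. Qed.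

Lemma residue_nilpotentD n (u v : chain X lt n.+1) :
  residue_nilpotent u -> residue_nilpotent v -> residue_nilpotent (u + v).
Proof.
by move=> un vn; rewrite -[v]opprK; apply/residue_nilpotentB/residue_nilpotentN.
Qed.

Lemma residue_nilpotent_sign n k (v : chain X lt n.+1) :
  residue_nilpotent v -> residue_nilpotent ((-1) ^+ k *: v).
Proof.
rewrite -signr_odd; case: odd => vn; last by rewrite expr0 scale1r.
by rewrite expr1 scaleN1r; apply: residue_nilpotentN.
Qed.

(** Well-founded induction on the end vertex [z], for all degrees and tuples at once: each term of
    the residue ends at a proper left divisor of [z]. *)
Lemma residue_nilpotent_bracket n (x : M) (a : n.+1.-tuple M) : admissible X a ->
  residue_nilpotent ((<< x >> : 'Z[M]) *: bracket a).
Proof.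
move zE : (x * left_lcm a)%g => z; move: n x a zE.
elim/(well_founded_ind (@proper_left_divisor_wf M)): z => z IHz n x a zE aA.
have [/andP[ua aX]|nX] := boolP (uniq a && all [in X] a); last first.
  by rewrite bracket0 // scaler0; apply: residue_nilpotent0.
have [_ [c ac]] := aA.
have a1 i : tnth a i != 1%g.
  by apply: contraNneq X1 => <-; apply: (allP aX); apply: mem_tnth.
(* Positive degree matters here: the lcm of a nonempty tuple is a left multiple of an entry other
   than 1. Hence the apex is a genuine element of [X]. *)
have z1 : z != 1%g.
  apply/eqP => z1; move: zE; rewrite z1 => /lg_conical[_ l1].
  have /common_left_multiple_tuple/(_ 0)[u] := left_lcm_multiple ac.
  rewrite l1 => /esym/lg_conical[_ /eqP]; apply/negP/a1.
have bA := admissible_cone x aA; have [_ [d bd]] := bA.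
have qK := cone_quotientK x aA; rewrite zE in bA bd qK.
set b := [tuple of generator_of z :: a] in bA bd qK.
set q := left_quotient z (left_lcm b) in qK.
(* The factor [w] will be the entry by which a face is divided. *)
have IH m y (t : m.+1.-tuple M) w : w != 1%g -> (y * left_lcm t * w = z)%g ->
    admissible X t -> residue_nilpotent ((<< y >> : 'Z[M]) *: bracket t).
  by move=> w1 tE; apply: (IHz (y * left_lcm t)%g) => //; exists w.
suff [k kP] : residue_nilpotent (residue ((<< x >> : 'Z[M]) *: bracket a)).
  by exists k.+1; rewrite iterSr.
rewrite residue_bracket // zE -/b -/q; apply: residue_nilpotentB.
  apply: (IH _ _ _ (tnth b 0)).
  - by rewrite tnth0; apply: contraNneq X1 => <-; case: (generator_ofP z1).
  - by rewrite -mulgA (left_lcm_omit_complement 0 bd).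
  - exact: admissible_omit_complement.
apply: (big_ind _ (@residue_nilpotent0 n) (@residue_nilpotentD n)) => i _.
apply/residue_nilpotent_sign/residue_nilpotentB.
  apply: (IH _ _ _ (tnth b (lift 0 i))).
  - by rewrite tnthS.
  - by rewrite -mulgA (left_lcm_omit_complement _ bd).
  - exact: admissible_omit_complement.
have oA := admissible_omit_complement X_complement i aA.
(* The cone over a divided face has the end vertex of that face, which still misses the factor
   [tnth a i]. *)
rewrite homotopy_bracket //; apply: (IH _ _ _ (tnth a i)) => //.
  rewrite left_quotientK -?mulgA ?(left_lcm_omit_complement _ ac) //.
  exact: cone_multiple.
exact: admissible_cone.
Qed.

Lemma admissible_cell n (A : cell X lt n) : admissible X (val A).
Proof.
have /and3P[AX _ /asboolP[c [Ac _]]] := valP A.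
by split; [move=> y /(allP AX); left|exists c].
Qed.

Lemma chain_residue_nilpotent n (v : chain X lt n.+1) : residue_nilpotent v.
Proof.
apply: malg_add_ind v.
- exact: residue_nilpotent0.
- exact: residue_nilpotentB.
move=> x A; rewrite -malg_scale_basis -(bracket_cell lt_linear).
exact/residue_nilpotent_bracket/admissible_cell.
Qed.

Lemma boundary_boundary n (v : chain X lt n.+2) :
  boundary X lt n (boundary X lt n.+1 v) = 0.
Proof.
apply: malg_linear_comp0 v => A.
have AA := admissible_cell A.
have := boundary_boundary_formula lt_linear X1 X_complement AA.
by rewrite -(boundary_bracket lt_linear X1 AA) (bracket_cell lt_linear).
Qed.

(** On a cycle [v] the residue only subtracts the boundary of [homotopy v], so it is a homologous
    cycle; iterating until it vanishes writes [v] as a boundary. *)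
Lemma exact_boundary n : exact_at (boundary X lt n.+1) (boundary X lt n).
Proof.
move=> v; split=> [v0|[u <-]]; last exact: boundary_boundary.
have [k vk] := chain_residue_nilpotent v.
elim: k v v0 vk => [|k IHk] v v0; first by move=> /= ->; exists 0; rewrite raddf0.
have rE : residue v = v - boundary X lt n.+1 (homotopy v).
  by rewrite /residue v0 raddf0 subr0.
have r0 : boundary X lt n (residue v) = 0.
  by rewrite rE raddfB /= v0 boundary_boundary subrr.
rewrite iterSr => /(IHk _ r0)[u uE].
by exists (u + homotopy v); rewrite raddfD /= uE rE subrK.
Qed.

(** * Degree zero: the augmentation ideal *)

Local Notation point := (bracket ([tuple] : 0.-tuple M)).

Lemma chain0E (v : chain X lt 0) : exists w : 'Z[M], v = w *: point.
Proof.
rewrite [v]malg_basis_sum.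
apply: (big_ind (fun v => exists w : 'Z[M], v = w *: point)).
- by exists 0; rewrite scale0r.
- by move=> _ _ [w ->] [w' ->]; exists (w + w'); rewrite scalerDl.
move=> A _; exists (v@_A); rewrite -(bracket_cell lt_linear).
refine (congr1 _ (congr1 _ _)); exact: tuple0.
Qed.

Lemma boundary0_point (w : 'Z[M]) :
  boundary0 X lt (w *: point) = augmentation M w.
Proof.
have nil1 : common_left_multiple ([tuple] : 0.-tuple M) 1%g by [].
have [A [f [_ ->]]] := bracket_cellP lt_linear (a := [tuple]) isT isT nil1.
have -> : f = 1%g by apply/permP => -[].
rewrite odd_perm1 expr0 scale1r linearZ /= /boundary0 linear_ext_basis.
exact: mulr1.
Qed.

Lemma augmentation_basis (x : M) : augmentation M << x >> = 1.
Proof. by rewrite /augmentation /= mmapU mulr1. Qed.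

Lemma left_lcm_nil : left_lcm [::] = 1%g :> M.
Proof.
have nil1 : common_left_multiple [::] (1%g : M) by [].
have /(left_lcmP nil1)[u /esym/lg_conical[]] := nil1.
by [].
Qed.

Lemma boundary_generator y : y \in X ->
  boundary X lt 0 (bracket [tuple y]) = (<< y >> - 1) *: point.
Proof.
move=> yX; have yA : admissible X [tuple y].
  split; first by move=> x; rewrite inE => /eqP->; left.
  by exists y => x; rewrite inE => /eqP->; apply: left_multiple_refl.
apply: etrans (boundary_bracket lt_linear X1 yA) _.
rewrite boundary_formulaE big_ord1 expr1 scaleN1r opprB scalerBl scale1r.
have oE : omit [tuple y] ord0 = [tuple] by exact: tuple0.
have cE : omit_complement [tuple y] ord0 = [tuple] by exact: tuple0.
by rewrite cE oE left_lcm_nil left_complementx1 tnth0.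
Qed.

Lemma scaler_sub1M (R : nzRingType) (V : lmodType R) (c d : R) (v : V) :
  c *: ((d - 1) *: v) + (c - 1) *: v = (c * d - 1) *: v.
Proof. by rewrite scalerA -scalerDl mulrBr mulr1 addrA subrK. Qed.

(** Induction on a word for [x], using [y x' - 1 = y (x' - 1) + (y - 1)]. *)
Lemma boundary_point (x : M) :
  exists u : chain X lt 1, boundary X lt 0 u = (<< x >> - 1) *: point.
Proof.
have [s sX ->] := X_generating x; elim: s sX => [_|y s IHs /andP[yX /IHs[u uE]]].
  by exists 0; rewrite raddf0 big_nil subrr scale0r.
exists (<< y >> *: u + bracket [tuple y]).
rewrite linearD linearZ /= uE (boundary_generator yX) big_cons -malgUM.
exact: scaler_sub1M.
Qed.

(** The elements [x - 1] span the augmentation ideal over the integers: [w] minus its augmentation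
    is the sum of the [w@_x (x - 1)]. *)
Lemma boundary_augmentation (w : 'Z[M]) : exists u : chain X lt 1,
  boundary X lt 0 u = (w - (augmentation M w)%:~R) *: point.
Proof.
pose Q v := exists u : chain X lt 1,
  boundary X lt 0 u = (v - (augmentation M v)%:~R) *: point.
suff: Q w by []; rewrite [w]monalgE; apply: (big_ind Q).
- by exists 0; rewrite linear0 rmorph0 mulr0z subrr scale0r.
- move=> v v' [u uE] [u' uE']; exists (u + u').
  rewrite raddfD /= uE uE'; apply: etrans (esym (scalerDl _ _ _)) _.
  refine (f_equal2 *:%R _ (erefl _)).
  by rewrite rmorphD intrD opprD addrACA.
move=> x _; have [u uE] := boundary_point x; exists (u *~ w@_x).
rewrite raddfMz /= uE.
have -> : << w@_x *g x >> = << x >> *~ w@_x :> 'Z[M] by rewrite -raddfMz /= intz.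
apply: etrans (scalerMzl _ _ _) _; refine (f_equal2 *:%R _ (erefl _)).
have aE : augmentation M (<< x >> *~ w@_x) = w@_x.
  apply: etrans (raddfMz (augmentation M) _ _) _; apply: etrans (intz _).
  refine (congr1 (fun c : int => c *~ w@_x) (augmentation_basis x)).
by rewrite aE mulrzBl.
Qed.

Lemma boundary0_boundary (u : chain X lt 1) :
  boundary0 X lt (boundary X lt 0 u) = 0.
Proof.
apply: malg_linear_comp0 u => A; case/and3P: (valP A) => AX _ _.
have [y yE] : exists y, val A = [tuple y].
  by case: (val A) => -[|y []] //= sz; exists y; apply/val_inj.
rewrite -(bracket_cell lt_linear) yE boundary_generator; last first.
  by move: AX; rewrite yE /= andbT.
by rewrite boundary0_point raddfB /= augmentation_basis rmorph1 subrr.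
Qed.

Lemma exact_boundary0 : exact_at (boundary X lt 0) (boundary0 X lt).
Proof.
move=> v; split=> [|[u <-]]; last exact: boundary0_boundary.
have [w ->] := chain0E v; rewrite boundary0_point => w0.
have [u uE] := boundary_augmentation w; exists u; apply: etrans uE _.
refine (f_equal2 *:%R _ (erefl _)).
have w0' : augmentation M w = 0 :> int by exact: w0.
by rewrite w0' mulr0z subr0.
Qed.

Lemma boundary0_surjective (z : trivialZ M) :
  exists x : chain X lt 0, boundary0 X lt x = z.
Proof. by exists (z%:~R *: point); rewrite boundary0_point rmorph_int intz. Qed.

End Contraction.

Local Open Scope ring_scope.

Theorem proposition2p6 (M : locallyGaussianType) (X : {pred M}) (lt : rel M) :
  generating X -> 1%g \notin X ->
  closed_right_lcm X -> closed_left_complement X -> closed_right_complement X ->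
  linear_ordering X lt ->
  [/\ forall z : trivialZ M, exists x : chain X lt 0, boundary0 X lt x = z,
      exact_at (boundary X lt 0) (boundary0 X lt) &
      forall n : nat, exact_at (boundary X lt n.+1) (boundary X lt n)].
Proof.
move=> X_generating X1 _ X_complement _ lt_linear; split=> [z||n].
- exact: boundary0_surjective.
- exact: exact_boundary0.
- exact: exact_boundary.
Qed.
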